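(* Let $c>0$ and consider $G_0(w)=\alpha^2+4c\beta^2-2\alpha(1-\beta)w+(1-2\beta)w^2$ with $\deg G_0=2$ (i.e. $\beta\neq1/2$), proportional to $(w-a)(w-b)$ with $a\neq b$, and put $\sigma=(1-\beta)/\beta$. (i) (Real root case.) Let $a,b\in\mathbb{R}$ with $a\ne b$, $a^2\geq4c$ and $b^2\geq 4c$, and consider the four solutions $$\sigma_{\epsilon_1,\epsilon_2}=\epsilon_1\frac{\sqrt{a^2-4c}+\epsilon_2\sqrt{b^2-4c}}{a-b},\qquad \epsilon_1,\epsilon_2\in\{+1,-1\},$$ counted according to the four sign choices. If $ab>0$, then the condition $\sigma>-1$ is satisfied by exactly two of them, and these two are positive. If $ab<0$, then all four solutions satisfy $\sigma>-1$. (ii) (Imaginary root case.) Let $\zeta\in\mathbb{C}\setminus\mathbb{R}$ and $a=\zeta=\overline{b}$ (so $G_0(\zeta)=0$). Among the real solutions $$\sigma=\pm\frac{\operatorname{Re}\sqrt{4c-\zeta^2}}{\operatorname{Im}\zeta}$$ there is exactly one satisfying $\sigma>-1$.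
   Context: For the one-step shift $S_{\alpha,\beta}(w)=1/(\alpha-w-2\beta\rho(w))$, $\rho(w)=\frac{-w+\sqrt{w^2-4c}}{2}$, one has $S_{\alpha,\beta}=(\alpha-(1-\beta)w+\beta\sqrt{w^2-4c})/G_0$. Positivity of the shift means $\alpha\in\mathbb{R}$ and $\beta>0$; for real parameters with $\beta\ne 0$, $\beta>0$ is equivalent to $\sigma=(1-\beta)/\beta>-1$. The proportionality of $G_0$ to $(w-a)(w-b)$ leads to the equation $(a-b)^2\sigma^4-2(a^2+b^2-8c)\sigma^2+(a+b)^2=0$, whose solutions for $a\ne b$ are $\sigma=\pm(\sqrt{a^2-4c}\pm\sqrt{b^2-4c})/(a-b)$. In (i) square roots are the nonnegative real ones; in (ii) $\sqrt{4c-\zeta^2}$ is either complex square root. *)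

(* Defs.v *)
From mathcomp Require Export all_boot all_order all_algebra.
From mathcomp.real_closed Require Export complex.

Set Implicit Arguments.
Unset Strict Implicit.
Unset Printing Implicit Defensive.

Export Order.TTheory GRing.Theory Num.Theory.
Global Open Scope ring_scope.
Global Open Scope complex_scope.

Definition G0 (K : fieldType) (c alpha beta : K) : {poly K} :=
  (alpha ^+ 2 + 4 * c * beta ^+ 2)%:P
  - (2 * alpha * (1 - beta)) *: 'X + (1 - 2 * beta) *: 'X^2.

(* [%=] is equality up to a nonzero constant factor.  The guard on [beta] makes
   the quotient defining [sigma] meaningful, since [x / 0 = 0]. *)
Definition solves (K : fieldType) (c a b alpha beta sigma : K) : Prop :=
  [/\ size (G0 c alpha beta) = 3%N,
      G0 c alpha beta %= ('X - a%:P) * ('X - b%:P),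
      beta != 0
    & sigma = (1 - beta) / beta].

(* The signs are encoded by booleans: [false] is [+1] and [true] is [-1]. *)
Definition sigma_eps (R : rcfType) (c a b : R) (e : bool * bool) : R :=
  (-1) ^+ e.1 * ((Num.sqrt (a ^+ 2 - 4 * c)
                  + (-1) ^+ e.2 * Num.sqrt (b ^+ 2 - 4 * c)) / (a - b)).

(* Main.v *)
Require Import Defs.
From mathcomp Require Import ring lra.

(** With [A = alpha / beta], comparing coefficients of [G0] and
    [(w - a) (w - b)] gives [A ^ 2 + 4 c = (sigma ^ 2 - 1) a b] and
    [2 A sigma = (sigma ^ 2 - 1) (a + b)]; eliminating [A] gives the quartic.
    If [p] and [q] are square roots of [a ^ 2 - 4 c] and [b ^ 2 - 4 c], the
    quartic times [(a - b) ^ 2] is the product of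
    [((a - b) sigma) ^ 2 - (p + q) ^ 2] and [((a - b) sigma) ^ 2 - (p - q) ^ 2].
    In the real case [(p q) ^ 2 < (a b - 4 c) ^ 2], so all four roots have
    modulus greater than [1] when [a b > 0] and less than [1] when [a b < 0].
    In the imaginary case [p = i r] and [q = i r^*]; a solution with [alpha] and
    [beta] real has [sigma ^ 2 > 1], which excludes the roots with [p - q]: their
    real part is [0]. *)

(** * Coefficient relations and the quartic satisfied by [sigma] *)

(** Since [1 + sigma = 1 / beta], the factor [alpha * (1 + sigma)] is [A], and
    [sigma ^ 2 - 1 = (1 - 2 beta) / beta ^ 2] turns the degree condition into [sigma ^ 2 != 1]. *)
Lemma solvesP (K : fieldType) (c a b alpha beta sigma : K) :
  solves c a b alpha beta sigma <->
  [/\ sigma ^+ 2 != 1, beta * (1 + sigma) = 1,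
      (alpha * (1 + sigma)) ^+ 2 + 4 * c = (sigma ^+ 2 - 1) * (a * b)
    & 2 * (alpha * (1 + sigma)) * sigma = (sigma ^+ 2 - 1) * (a + b)].
Proof.
rewrite /solves; set p := ('X - a%:P) * ('X - b%:P).
have coefG i : (G0 c alpha beta)`_i =
    (alpha ^+ 2 + 4 * c * beta ^+ 2) * (i == 0%N)%:R
    - 2 * alpha * (1 - beta) * (i == 1%N)%:R + (1 - 2 * beta) * (i == 2)%:R.
  by rewrite /G0 !coefE; case: i => [|[|[|i]]] /=; ring.
have pE : p = (a * b)%:P - (a + b) *: 'X + 'X^2.
  by rewrite /p -!mul_polyC rmorphM rmorphD /=; ring.
have coefp i : p`_i =
    a * b * (i == 0%N)%:R - (a + b) * (i == 1%N)%:R + (i == 2)%:R.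
  by rewrite pE !coefE; case: i => [|[|[|i]]] /=; ring.
have size_p : size p = 3%N.
  by rewrite /p size_mul ?polyXsubC_eq0 // !size_XsubC.
split.
- case=> sz /eqpP[[k1 k2] /= /andP[k1n0 k2n0] kE] bn0 ->.
  have lead : 1 - 2 * beta != 0.
    have : (G0 c alpha beta)`_2 != 0.
      by rewrite -[2%N]/(3.-1) -sz -lead_coefE lead_coef_eq0 -size_poly_eq0 sz.
    by rewrite coefG /= !mulr0 subr0 add0r mulr1.
  have coefk i : k1 * (G0 c alpha beta)`_i = k2 * p`_i by rewrite -!coefZ kE.
  (* Leading coefficients fix the factor of proportionality: [G0] is [(1 - 2 beta) p]. *)
  have k21 : k2 = k1 * (1 - 2 * beta).
    have := coefk 2; rewrite coefG coefp /= !mulr0 !mulr1 => H.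
    by rewrite !subr0 !add0r mulr1 in H.
  have e0 : alpha ^+ 2 + 4 * c * beta ^+ 2 = (1 - 2 * beta) * (a * b).
    apply: (mulfI k1n0); have := coefk 0%N.
    by rewrite coefG coefp k21 /= !(mulr0, mulr1, subr0, addr0) -(mulrA k1).
  have e1 : 2 * alpha * (1 - beta) = (1 - 2 * beta) * (a + b).
    apply: (mulfI k1n0); have := coefk 1%N.
    rewrite coefG coefp k21 /= !(mulr0, mulr1, sub0r, addr0) !mulrN.
    by rewrite -(mulrA k1); move/oppr_inj.
  split.
  + rewrite -subr_eq0.
    have -> : ((1 - beta) / beta) ^+ 2 - 1 = (1 - 2 * beta) / beta ^+ 2.
      by field.
    by rewrite mulf_neq0 // invr_neq0 // expf_neq0.
  + by field.
  + have -> : (alpha * (1 + (1 - beta) / beta)) ^+ 2 + 4 * c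
            = (alpha ^+ 2 + 4 * c * beta ^+ 2) / beta ^+ 2 by field.
    by rewrite e0; field.
  + have -> : 2 * (alpha * (1 + (1 - beta) / beta)) * ((1 - beta) / beta)
            = (2 * alpha * (1 - beta)) / beta ^+ 2 by field.
    by rewrite e1; field.
- case=> s2 bs e0 e1.
  have bn0 : beta != 0.
    by apply: contra_eq_neq bs => ->; rewrite mul0r eq_sym oner_neq0.
  have sE : sigma = (1 - beta) / beta.
    by apply: (mulfI bn0); rewrite mulrCA divff // mulr1 -bs; ring.
  have eG : G0 c alpha beta = (1 - 2 * beta) *: p.
    have bE : beta ^+ 2 * (sigma ^+ 2 - 1) = 1 - 2 * beta.
      by rewrite sE; field.
    apply/polyP => i; rewrite coefG coefZ coefp -bE.
    case: i => [|[|i]] /=;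
      rewrite ?(mulr0, mulr1, oppr0, subr0, sub0r, addr0, add0r) //.
    + by rewrite -[RHS]mulrA -e0 sE; field.
    + by rewrite mulrN -(mulrA (beta ^+ 2)) -e1 sE; field.
  have lead : 1 - 2 * beta != 0.
    apply: contra s2 => /eqP lead0; rewrite -subr_eq0 sE.
    have -> : ((1 - beta) / beta) ^+ 2 - 1 = (1 - 2 * beta) / beta ^+ 2.
      by field.
    by rewrite lead0 mul0r.
  split=> //; first by rewrite eG size_scale.
  by rewrite eG eqp_scale // eqpxx.
Qed.

Definition quartic {K : fieldType} (c a b sigma : K) : K :=
  (a - b) ^+ 2 * sigma ^+ 4 - 2 * (a ^+ 2 + b ^+ 2 - 8 * c) * sigma ^+ 2
  + (a + b) ^+ 2.

Lemma solves_quartic (K : fieldType) (c a b alpha beta sigma : K) :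
  solves c a b alpha beta sigma -> quartic c a b sigma = 0.
Proof.
move=> /solvesP[_ _]; set A := alpha * _ => e0 e1.
(* Written through the right-hand sides of both relations, the quartic becomes [(2 A sigma) ^ 2 + 16
   c sigma ^ 2 - 4 sigma ^ 2 (A ^ 2 + 4 c)], which vanishes. *)
have -> : quartic c a b sigma
  = ((sigma ^+ 2 - 1) * (a + b)) ^+ 2 + 16 * c * sigma ^+ 2
    - 4 * sigma ^+ 2 * ((sigma ^+ 2 - 1) * (a * b)) by rewrite /quartic; ring.
by rewrite -e0 -e1; ring.
Qed.

(** For nonzero [sigma] the second relation determines [A]; with this [A], the quartic is
    [(2 sigma) ^ 2] times the difference of the two sides of the first relation. *)
Lemma quartic_solves (K : fieldType) (c a b sigma : K) :
  (2 : K) != 0 -> c != 0 -> sigma != 0 -> quartic c a b sigma = 0 ->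
  solves c a b ((sigma ^+ 2 - 1) * (a + b) / (2 * sigma) / (1 + sigma))
    (1 + sigma)^-1 sigma.
Proof.
move=> n2 cn0 sn0 Q.
(* At [sigma ^ 2 = 1] the quartic takes the nonzero value [16 c]. *)
have s2 : sigma ^+ 2 != 1.
  apply: contra_eq_neq Q => s2; rewrite /quartic.
  rewrite (exprM sigma 2 2) s2 expr1n.
  rewrite (_ : _ + _ = 2 ^+ 4 * c); last by ring.
  by rewrite mulf_neq0 // expf_neq0.
have s1 : 1 + sigma != 0.
  apply: contra s2 => /eqP s1; rewrite -subr_eq0.
  have -> : sigma ^+ 2 - 1 = (1 + sigma) * (sigma - 1) by ring.
  by rewrite s1 mul0r.
apply/solvesP; rewrite !divfK // mulVf //; split=> //;
  last by field; rewrite sn0.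
apply/eqP; rewrite -subr_eq0; apply/eqP.
have -> : ((sigma ^+ 2 - 1) * (a + b) / (2 * sigma)) ^+ 2 + 4 * c
    - (sigma ^+ 2 - 1) * (a * b) = quartic c a b sigma / (2 * sigma) ^+ 2.
  by rewrite /quartic; field; rewrite sn0.
by rewrite Q mul0r.
Qed.

(** * Factorisation of the quartic *)

(** The field and the square roots [p], [q] are left arbitrary so that both cases are covered: real
    [p] and [q], and [p = i r], [q = i r^*]. *)
Lemma quartic_eq0 (K : fieldType) (c a b p q sigma : K) :
  a != b -> p ^+ 2 = a ^+ 2 - 4 * c -> q ^+ 2 = b ^+ 2 - 4 * c ->
  quartic c a b sigma = 0 <->
  exists e : bool * bool,
    sigma = (-1) ^+ e.1 * ((p + (-1) ^+ e.2 * q) / (a - b)).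
Proof.
rewrite -subr_eq0 => abn0 hp hq.
have ab2n0 : (a - b) ^+ 2 != 0 by rewrite expf_neq0.
have Q : (a - b) ^+ 2 * quartic c a b sigma
  = (((a - b) * sigma) ^+ 2 - (p + q) ^+ 2)
    * (((a - b) * sigma) ^+ 2 - (p - q) ^+ 2).
  (* The product involves [p] and [q] only through [p ^ 2 + q ^ 2] and [(p ^ 2 - q ^ 2) ^ 2], that
     is [a ^ 2 + b ^ 2 - 8 c] and [(a ^ 2 - b ^ 2) ^ 2]. *)
  have -> : (((a - b) * sigma) ^+ 2 - (p + q) ^+ 2)
      * (((a - b) * sigma) ^+ 2 - (p - q) ^+ 2)
    = ((a - b) * sigma) ^+ 4
      - 2 * (p ^+ 2 + q ^+ 2) * ((a - b) * sigma) ^+ 2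
      + (p ^+ 2 - q ^+ 2) ^+ 2 by ring.
  by rewrite hp hq /quartic; ring.
split.
- move=> Q0; move: Q; rewrite Q0 mulr0 => /esym/eqP.
  rewrite mulf_eq0 !subr_eq0 !eqf_sqr.
  have div t : (a - b) * sigma = t -> sigma = t / (a - b).
    by move=> <-; rewrite mulrC mulKf.
  case/orP=> /orP[] /eqP/div->; [exists (false, false)|exists (true, false)
    |exists (false, true)|exists (true, true)];
    rewrite /= ?expr0 ?expr1; by field.
- case=> e sE; apply: (mulfI ab2n0); rewrite mulr0 Q sE.
  by case: e {sE} => [[] []]; rewrite /= ?expr0 ?expr1; by field.
Qed.

(** * Real root case: the four solutions and their moduli *)

Lemma realc_inj (R : rcfType) : injective (fun x : R => x%:C).
Proof. exact: fmorph_inj. Qed.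

Lemma sigma_epsC (R : rcfType) (c a b : R) (e : bool * bool) :
  (sigma_eps c a b e)%:C =
  (-1) ^+ e.1 * (((Num.sqrt (a ^+ 2 - 4 * c))%:C
    + (-1) ^+ e.2 * (Num.sqrt (b ^+ 2 - 4 * c))%:C) / (a%:C - b%:C)).
Proof.
by rewrite /sigma_eps !(rmorphM, rmorphD, rmorphXn, rmorphN, rmorph1, fmorphV).
Qed.

(** Letting [sigma] range over the complex numbers shows that every solution is real. *)
Lemma real_solvesP (R : rcfType) (c a b : R) (sigma : R[i]) :
  0 < c -> a != b -> 4 * c <= a ^+ 2 -> 4 * c <= b ^+ 2 ->
  (exists alpha beta : R[i], solves c%:C a%:C b%:C alpha beta sigma) <->
  (exists e : bool * bool, sigma = (sigma_eps c a b e)%:C).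
Proof.
move=> c0 ab ha hb.
have sqrtC x : 4 * c <= x ^+ 2 ->
    (Num.sqrt (x ^+ 2 - 4 * c))%:C ^+ 2 = x%:C ^+ 2 - 4 * c%:C.
  move=> hx; rewrite -rmorphXn sqr_sqrtr ?subr_ge0 //.
  by rewrite rmorphB rmorphXn rmorphM rmorph_nat.
have abC : a%:C != b%:C by rewrite (inj_eq (@realc_inj R)).
have nz (x : R) : x != 0 -> x%:C != 0 by rewrite fmorph_eq0.
have QE := quartic_eq0 _ _ _ _ _ _ sigma abC (sqrtC _ ha) (sqrtC _ hb).
split.
- case=> al [be /(solves_quartic _ _ _ _ _ _)/QE[e ->]]; exists e.
  by rewrite sigma_epsC.
- case=> e sE.
  have Q0 : quartic c%:C a%:C b%:C sigma = 0.
    by apply/QE; exists e; rewrite sE sigma_epsC.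
  have [s0|sn0] := eqVneq sigma 0; last first.
    do 2 eexists; apply: (quartic_solves _ _ _ _ _ _ _ _ Q0) => //;
      last by rewrite nz ?gt_eqF.
    by rewrite pnatr_eq0.
  (* At [sigma = 0] the quartic forces [b = - a], and [alpha] is then a square
     root of [a ^+ 2 - 4 * c]. *)
  have ba : b%:C = - a%:C.
    apply/eqP; rewrite -addr_eq0 addrC -sqrf_eq0 -Q0 /quartic s0.
    by apply/eqP; ring.
  exists (Num.sqrt (a ^+ 2 - 4 * c))%:C, 1; apply/solvesP.
  rewrite s0 ba addr0 !mulr1 sqrtC // expr0n /=; split; try by ring.
  by rewrite eq_sym oner_eq0.
Qed.

(** The two sides differ by [4 c (a - b) ^ 2]. *)
Lemma sqr_mul_sqrt_lt (R : realDomainType) (a b c p q : R) :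
  0 < c -> a != b -> p ^+ 2 = a ^+ 2 - 4 * c -> q ^+ 2 = b ^+ 2 - 4 * c ->
  (p * q) ^+ 2 < (a * b - 4 * c) ^+ 2.
Proof.
move=> c0 ab p2 q2.
have -> : (p * q) ^+ 2 = (a * b - 4 * c) ^+ 2 - 4 * c * (a - b) ^+ 2.
  by rewrite exprMn p2 q2; ring.
rewrite ltrBlDr ltrDl pmulr_rgt0; first by rewrite exprn_even_gt0 //= subr_eq0.
by rewrite mulr_gt0.
Qed.

(** Clearing the denominator leaves [(p ± q) ^ 2 < (a - b) ^ 2], that is [± p q < 4 c - a b]. The
    right-hand side is positive here, so the bound on [(p q) ^ 2] gives both signs. *)
Lemma sigma_eps_sqr_lt1 (R : rcfType) (a b c : R) e :
  0 < c -> a != b -> 4 * c <= a ^+ 2 -> 4 * c <= b ^+ 2 ->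
  a * b < 0 -> sigma_eps c a b e ^+ 2 < 1.
Proof.
move=> c0 ab ha hb ab0; rewrite /sigma_eps exprMn sqrr_sign mul1r expr_div_n.
rewrite ltr_pdivrMr ?mul1r; last by rewrite exprn_even_gt0 //= subr_eq0.
move: (sqrtr_ge0 (a ^+ 2 - 4 * c)) (sqrtr_ge0 (b ^+ 2 - 4 * c)).
have: Num.sqrt (a ^+ 2 - 4 * c) ^+ 2 = a ^+ 2 - 4 * c.
  by rewrite sqr_sqrtr ?subr_ge0.
have: Num.sqrt (b ^+ 2 - 4 * c) ^+ 2 = b ^+ 2 - 4 * c.
  by rewrite sqr_sqrtr ?subr_ge0.
move: (Num.sqrt (a ^+ 2 - _)) (Num.sqrt (b ^+ 2 - _)) => p q q2 p2 p0 q0.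
have pq0 : 0 <= p * q by exact: mulr_ge0.
have pq : p * q < 4 * c - a * b.
  rewrite -(@ltr_pXn2r _ 2) // ?nnegrE //; last by nra.
  by rewrite -[X in _ < X]sqrrN opprB; exact: sqr_mul_sqrt_lt p2 q2.
by case: e.2; rewrite ?expr0 ?expr1 ?mulN1r ?mul1r; nra.
Qed.

(** The reversed inequality amounts to [± p q > 4 c - a b]; it follows from [p q < a b - 4 c], where
    now [a b >= 4 c]. *)
Lemma sigma_eps_sqr_gt1 (R : rcfType) (a b c : R) e :
  0 < c -> a != b -> 4 * c <= a ^+ 2 -> 4 * c <= b ^+ 2 ->
  0 < a * b -> 1 < sigma_eps c a b e ^+ 2.
Proof.
move=> c0 ab ha hb ab0; rewrite /sigma_eps exprMn sqrr_sign mul1r expr_div_n.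
rewrite ltr_pdivlMr ?mul1r; last by rewrite exprn_even_gt0 //= subr_eq0.
move: (sqrtr_ge0 (a ^+ 2 - 4 * c)) (sqrtr_ge0 (b ^+ 2 - 4 * c)).
have: Num.sqrt (a ^+ 2 - 4 * c) ^+ 2 = a ^+ 2 - 4 * c.
  by rewrite sqr_sqrtr ?subr_ge0.
have: Num.sqrt (b ^+ 2 - 4 * c) ^+ 2 = b ^+ 2 - 4 * c.
  by rewrite sqr_sqrtr ?subr_ge0.
move: (Num.sqrt (a ^+ 2 - _)) (Num.sqrt (b ^+ 2 - _)) => p q q2 p2 p0 q0.
have c4 : 0 <= 4 * c by lra.
have ab_ge : 4 * c <= a * b.
  rewrite -(@ler_pXn2r _ 2) // ?nnegrE //; last exact: ltW.
  by rewrite [(a * b) ^+ 2]exprMn [(4 * c) ^+ 2]expr2 ler_pM.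
have pq0 : 0 <= p * q by exact: mulr_ge0.
have pq : p * q < a * b - 4 * c.
  by rewrite -(@ltr_pXn2r _ 2) // ?nnegrE ?subr_ge0 //;
     exact: sqr_mul_sqrt_lt p2 q2.
by case: e.2; rewrite ?expr0 ?expr1 ?mulN1r ?mul1r; nra.
Qed.

(** * From the modulus of [sigma] to the condition [sigma > -1] *)

Lemma gtN1_of_sqr_lt1 (R : realDomainType) (x : R) : x ^+ 2 < 1 -> -1 < x.
Proof. move=> h; nra. Qed.

Lemma sqr_gt1_gtN1 (R : realDomainType) (x : R) :
  1 < x ^+ 2 -> (-1 < x) = (0 < x).
Proof. by move=> h; apply/idP/idP => h'; nra. Qed.

Lemma card_sigma_eps (R : rcfType) (c a b : R) :
  (forall e, 1 < sigma_eps c a b e ^+ 2) ->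
  #|[set e : bool * bool | -1 < sigma_eps c a b e]| = 2%N.
Proof.
move=> gt1.
pose t e2 := sigma_eps c a b (false, e2).
have sgnE e1 e2 : sigma_eps c a b (e1, e2) = (-1) ^+ e1 * t e2.
  by rewrite /t /sigma_eps /= mul1r.
have t0 e2 : t e2 != 0.
  have := gt1 (false, e2); rewrite -/(t e2); apply: contraTneq => ->.
  by rewrite expr2 mul0r ltr10.
(* The four values come in opposite nonzero pairs [± t e2], so each [e2] admits exactly one outer
   sign: the one making the value positive. *)
rewrite (_ : [set e | _] = [set (t e2 < 0, e2) | e2 in [set: bool]]).
  by rewrite card_imset ?cardsT ?card_bool // => x y [].
apply/setP => -[e1 e2]; rewrite inE sqr_gt1_gtN1 // sgnE.
apply/idP/imsetP => [h|[e2' _ [-> ->]]].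
- exists e2; rewrite ?inE //; congr (_, _).
  move: h; case: e1; rewrite ?expr0 ?expr1 ?mulN1r ?mul1r ?oppr_gt0 => h.
    by rewrite h.
  by rewrite ltNge ltW.
- have := t0 e2'; case: (ltrgt0P (t e2')) => h _ //=.
    by rewrite expr0 mul1r.
  by rewrite expr1 mulN1r oppr_gt0.
Qed.

(** * Imaginary root case: conjugate roots *)

(** With [zeta = x + i y] and [r = u + i v], one has [u ^ 2 - v ^ 2 = 4 c - x ^ 2 + y ^ 2] and
    [u v = - x y]. If [u ^ 2 <= y ^ 2], the second forces [x ^ 2 <= v ^ 2], and then the first gives
    [u ^ 2 > y ^ 2]. *)
Lemma conj_sqr_gt1 (R : rcfType) (c : R) (zeta r : R[i]) :
  0 < c -> complex.Im zeta != 0 -> r ^+ 2 = 4 * c%:C - zeta ^+ 2 ->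
  1 < (complex.Re r / complex.Im zeta) ^+ 2.
Proof.
move=> c0; case: zeta r => [x y] [u v] /= y0.
rewrite (_ : 4 * c%:C = (4 * c)%:C); last by rewrite rmorphM rmorph_nat.
move=> /eqP; rewrite eq_complex !expr2 /= => /andP[/eqP re /eqP im].
have y2 : 0 < y ^+ 2 by rewrite exprn_even_gt0.
rewrite -expr2 expr_div_n ltr_pdivlMr // mul1r ltNge; apply/negP => uy.
have uv : u * v = - (x * y) by lra.
suff : x ^+ 2 <= v ^+ 2 by lra.
rewrite -(ler_pM2r y2) -exprMn -sqrrN -uv exprMn mulrC.
by rewrite ler_wpM2l ?sqr_ge0.
Qed.

(** The roots with [p + q] are [± u / y] and those with [p - q] are [± i v / y]. When [v = 0] the
    latter are [0], hence real, and only the reality of [alpha] rules them out. *)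
Lemma conj_solvesP (R : rcfType) (c : R) (zeta r : R[i]) (sigma : R) :
  0 < c -> complex.Im zeta != 0 -> r ^+ 2 = 4 * c%:C - zeta ^+ 2 ->
  (exists alpha beta : R,
     solves c%:C zeta (zeta^*)%C alpha%:C beta%:C sigma%:C) <->
  (sigma = complex.Re r / complex.Im zeta
   \/ sigma = - (complex.Re r / complex.Im zeta)).
Proof.
move=> c0; case: zeta r => [x y] [u v] /= y0 rE.
have real4 : 4 * c%:C = (4 * c)%:C by rewrite rmorphM rmorph_nat.
set zeta := x +i* y in rE *; set r := u +i* v in rE *.
have i2 : (0 +i* 1 : R[i]) ^+ 2 = -1.
  apply/eqP; rewrite expr2 eq_complex /=.
  by rewrite !mulr0 !mul0r addr0 mulr1 sub0r oppr0 !eqxx.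
have p2 : ((0 +i* 1) * r) ^+ 2 = zeta ^+ 2 - 4 * c%:C.
  by rewrite exprMn i2 rE; ring.
have q2 : ((0 +i* 1) * (r^*)%C) ^+ 2 = (zeta^*)%C ^+ 2 - 4 * c%:C.
  rewrite exprMn.
  have -> : (r^*)%C ^+ 2 = (4 * c)%:C - (zeta^*)%C ^+ 2.
    by rewrite -(conjc_real (4 * c)) -!rmorphXn -rmorphB rE real4.
  by rewrite i2 real4; ring.
have zetaB : zeta - (zeta^*)%C != 0.
  rewrite eq_complex /= negb_and opprK; apply/orP; right.
  by rewrite -mulr2n mulrn_eq0 negb_or.
have zetaN : zeta != (zeta^*)%C by rewrite -subr_eq0.
have sumE : ((0 +i* 1) * r + (0 +i* 1) * (r^*)%C) / (zeta - (zeta^*)%C)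
    = (u / y)%:C.
  apply: (canLR (mulfK zetaB)); apply/eqP; rewrite eq_complex /=.
  by apply/andP; split; apply/eqP; field.
have difE : ((0 +i* 1) * r - (0 +i* 1) * (r^*)%C) / (zeta - (zeta^*)%C)
    = 0 +i* (v / y).
  apply: (canLR (mulfK zetaB)); apply/eqP; rewrite eq_complex /=.
  by apply/andP; split; apply/eqP; field.
have QE := quartic_eq0 _ _ _ _ _ _ sigma%:C zetaN p2 q2.
split.
- case=> al [be sol].
  have [_ _ e0 _] := (solvesP _ _ _ _ _ _ _).1 sol.
  have zM : zeta * (zeta^*)%C = (x ^+ 2 + y ^+ 2)%:C.
    by apply/eqP; rewrite eq_complex /=; apply/andP; split; apply/eqP; ring.
  have {e0} e0 : (al * (1 + sigma)) ^+ 2 + 4 * c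
      = (sigma ^+ 2 - 1) * (x ^+ 2 + y ^+ 2).
    apply: (@realc_inj R).
    transitivity ((sigma%:C ^+ 2 - 1) * (zeta * (zeta^*)%C)).
      rewrite -e0.
      by rewrite !(rmorphD, rmorphXn, rmorphM, rmorph1, rmorph_nat).
    by rewrite zM !(rmorphM, rmorphB, rmorphXn, rmorph1).
  (* At [sigma = 0] the left side of [e0] is positive and the right side is not. *)
  have sn0 : sigma != 0.
    apply/eqP => s0; have := sqr_ge0 (al * (1 + sigma)).
    have := sqr_ge0 x; have := sqr_ge0 y; move: e0; rewrite s0; lra.
  have /QE[[e1 [] /=]] := solves_quartic _ _ _ _ _ _ _ sol.
  + rewrite expr1 mulN1r difE => sE; case/eqP: sn0.
    have := congr1 (@complex.Re R) sE.
    by case: (e1); rewrite ?expr0 ?expr1 ?mulN1r ?mul1r /= ?oppr0.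
  + rewrite expr0 mul1r sumE => sE.
    case: e1 sE; rewrite ?expr0 ?expr1 ?mulN1r ?mul1r -?rmorphN.
      by move/realc_inj; right.
    by move/realc_inj; left.
- move=> sE.
  have sn0 : sigma != 0.
    have s_gt1 : 1 < (u / y) ^+ 2 by exact: (conj_sqr_gt1 _ _ zeta r c0 y0 rE).
    suff : u / y != 0 by case: sE => ->; rewrite ?oppr_eq0.
    by apply/eqP => s0; move: s_gt1; rewrite s0 expr2 mul0r ltr10.
  have Q0 : quartic c%:C zeta (zeta^*)%C sigma%:C = 0.
    apply/QE; case: sE => ->; [exists (false, false)|exists (true, false)];
      by rewrite /= ?expr0 ?expr1 ?mulN1r !mul1r sumE ?rmorphN.
  (* These are the witnesses of [quartic_solves], real because [a + b] is here [2 x]. *)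
  exists ((sigma ^+ 2 - 1) * (2 * x) / (2 * sigma) / (1 + sigma)),
    (1 + sigma)^-1.
  have zD : zeta + (zeta^*)%C = (2 * x)%:C.
    by apply/eqP; rewrite eq_complex /=; apply/andP; split; apply/eqP; ring.
  have -> : ((sigma ^+ 2 - 1) * (2 * x) / (2 * sigma) / (1 + sigma))%:C
    = (sigma%:C ^+ 2 - 1) * (zeta + (zeta^*)%C) / (2 * sigma%:C)
      / (1 + sigma%:C).
    by rewrite zD !(rmorphM, rmorphB, rmorphD, rmorphXn, rmorph1, rmorph_nat,
      fmorphV).
  rewrite fmorphV rmorphD rmorph1; apply: quartic_solves => //.
  + by rewrite pnatr_eq0.
  + by rewrite fmorph_eq0 gt_eqF.
  + by rewrite fmorph_eq0.
Qed.

Theorem corollary5p2 (R : rcfType) (c : R) (c_gt0 : 0 < c) :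
  (forall a b : R, a != b -> 4 * c <= a ^+ 2 -> 4 * c <= b ^+ 2 ->
    [/\ forall sigma : R[i],
          (exists alpha beta : R[i],
             solves c%:C a%:C b%:C alpha beta sigma) <->
          (exists e : bool * bool, sigma = (sigma_eps c a b e)%:C),
        0 < a * b ->
          #|[set e : bool * bool | -1 < sigma_eps c a b e]| = 2%N /\
          (forall e : bool * bool,
             -1 < sigma_eps c a b e -> 0 < sigma_eps c a b e)
      & a * b < 0 -> forall e : bool * bool, -1 < sigma_eps c a b e])
  /\
  (forall zeta : R[i], complex.Im zeta != 0 ->
   forall r : R[i], r ^+ 2 = 4 * c%:C - zeta ^+ 2 ->
    let s := complex.Re r / complex.Im zeta in
    (forall sigma : R,
       (exists alpha beta : R,
          solves c%:C zeta (zeta^*)%C alpha%:C beta%:C sigma%:C) <->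
       (sigma = s \/ sigma = - s)) /\
    (exists! sigma : R, (sigma = s \/ sigma = - s) /\ -1 < sigma)).
Proof.
split=> [a b ab ha hb | zeta y0 r rE s].
- split=> [sigma | ab0 | ab0 e].
  + exact: real_solvesP.
  + have gt1 e : 1 < sigma_eps c a b e ^+ 2 by exact: sigma_eps_sqr_gt1.
    by split=> [|e]; [exact: card_sigma_eps | rewrite sqr_gt1_gtN1].
  + exact/gtN1_of_sqr_lt1/sigma_eps_sqr_lt1.
- split=> [sigma|]; first exact: conj_solvesP.
  have s_gt1 : 1 < s ^+ 2 by exact: conj_sqr_gt1 rE.
  have sN_gt1 : 1 < (- s) ^+ 2 by rewrite sqrrN.
  (* As [s ^ 2 > 1], only the positive one of [s] and [- s] exceeds [-1]. The witness is [s] when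
     [0 < s], which is what [s_lt0] states, and [- s] when [s < 0]. *)
  have [s_lt0|s_gt0|s0] := ltrgt0P s; last 1 first.
  + by move: s_gt1; rewrite s0 expr2 mul0r ltr10.
  + exists s; split=> [|t [[->|->] //]]; first by split; [left|lra].
    by rewrite sqr_gt1_gtN1 // oppr_gt0 ltNge ltW.
  + exists (- s); split=> [|t [[->|->] //]]; first by split; [right|lra].
    by rewrite sqr_gt1_gtN1 // ltNge ltW.
Qed.
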